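(* Let $P$ be an $L$-Fourier multiplier with symbol $\sigma_P:\mathcal I\to\mathbb C$. Then $P$ is globally $L$-hypoelliptic if and only if there exists $M>0$ such that for all $\xi\in\mathcal I$ $$\langle \xi\rangle\ge M \implies |\sigma_P(\xi)|>\langle\xi\rangle^{-M}.$$
   Context: Setting. $\Omega\subset\mathbb R^n$ is a bounded open set and $L$ is a differential operator of order $m$ with smooth coefficients in $\Omega$, equipped with linear boundary conditions (BC) (the functions satisfying them form a linear space). $L$ has discrete spectrum $\{\lambda_\xi\in\mathbb C:\xi\in\mathcal I\}$, where $\mathcal I$ is a countable set (without loss of generality $\mathcal I\subset\mathbb Z^K$ for some $K\ge1$), with $|\lambda_\xi|\to\infty$ as $|\xi|\to\infty$ and $|j|\le|k|\Rightarrow|\lambda_j|\le|\lambda_k|$. $L$ need not be self-adjoint or elliptic. $L^*$ is the adjoint with conjugate boundary conditions (BC)*. The eigenfunctions satisfy $Lu_\xi=\lambda_\xi u_\xi$ (with (BC)) and $L^*v_\xi=\overline{\lambda_\xi}v_\xi$ (with (BC)* ), and $\{u_\xi\},\{v_\xi\}$ are biorthogonal: $(u_\xi,v_\eta)_{L^2(\Omega)}=\delta_{\xi\eta}$. $\{u_\xi\}$ is a basis of $L^2(\Omega)$, hence so is $\{v_\xi\}$, and $\sum_\xi|(f,v_\xi)|^2$ and $\sum_\xi|(f,u_\xi)|^2$ are both comparable, from above and below with positive constants, to $\|f\|_{L^2(\Omega)}^2$. Weight: $\langle\xi\rangle:=(1+|\lambda_\xi|^2)^{1/(2m)}$. Test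 functions: $H^\infty_L(\overline\Omega):=\bigcap_{k\ge1}\mathrm{Dom}(L^k)$, $\mathrm{Dom}(L^k)=\{f\in L^2(\Omega):L^jf\in\mathrm{Dom}(L),\ 0\le j\le k-1\}$, with the Fréchet topology of the seminorms $\|\varphi\|_{H^k_L}=\max_{j\le k}\|L^j\varphi\|_{L^2(\Omega)}$; $H^\infty_{L^*}(\overline\Omega)$ is defined likewise from $L^*$. For $L_0\in\{L,L^*\}$, limits in the $H^\infty_{L_0}(\overline\Omega)$ topology of elements of $H^\infty_{L_0}(\overline\Omega)$ belong to $H^\infty_{L_0}(\overline\Omega)$. These spaces are taken to be stable under complex conjugation. The space of $L$-distributions is $H^{-\infty}_L(\Omega)$, the continuous linear functionals on $H^\infty_{L^*}(\overline\Omega)$; $H^\infty_L(\overline\Omega)$ embeds in it via $\langle\psi,\varphi\rangle=\int_\Omega\psi\varphi\,dx$. $\mathcal S(\mathcal I)$: functions $\varphi:\mathcal I\to\mathbb C$ such that for every $M>0$ there is $C_M$ with $|\varphi(\xi)|\le C_M\langle\xi\rangle^{-M}$. $\mathcal S'(\mathcal I)$: functions with $|\varphi(\xi)|\le C\langle\xi\rangle^M$ for some $C,M>0$. $L$-Fourier transform: $\widehat f(\xi)=(f,v_\xi)_{L^2(\Omega)}$ for test functions, $\widehat w(\xi)=\langle w,\overline{v_\xi}\rangle$ for $L$-distributions. Standing fact: it is a bijective homeomorphism $H^\infty_L(\overline\Omega)\to\mathcal S(\mathcal I)$ and $H^{-\infty}_L(\Omega)\to\mathcal S'(\mathcal I)$.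 An $L$-Fourier multiplier with symbol $\sigma_A:\mathcal I\to\mathbb C$ is a continuous linear $A:H^\infty_L(\overline\Omega)\to H^\infty_L(\overline\Omega)$ with $\widehat{Af}(\xi)=\sigma_A(\xi)\widehat f(\xi)$. It extends to $H^{-\infty}_L(\Omega)$ by $\langle Aw,\varphi\rangle:=\langle w,\overline{A^*\overline\varphi}\rangle$, $\varphi\in H^\infty_{L^*}(\overline\Omega)$, where $A^*:H^\infty_{L^*}(\overline\Omega)\to H^\infty_{L^*}(\overline\Omega)$ is the $L^2$-adjoint; then $\widehat{Aw}(\xi)=\sigma_A(\xi)\widehat w(\xi)$ also for $w\in H^{-\infty}_L(\Omega)$. $P:H^{-\infty}_L(\Omega)\to H^{-\infty}_L(\Omega)$ is globally $L$-hypoelliptic if $w\in H^{-\infty}_L(\Omega)$ and $Pw\in H^\infty_L(\overline\Omega)$ imply $w\in H^\infty_L(\overline\Omega)$. *)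

(* Defs.v *)
From HB Require Import structures.
From mathcomp Require Import all_boot all_order all_algebra.
From mathcomp Require Import finmap complex.
From mathcomp Require Import all_classical all_reals all_analysis.
Set Implicit Arguments. Unset Strict Implicit. Unset Printing Implicit Defensive.
Import Order.TTheory GRing.Theory Num.Theory.
Import numFieldNormedType.Exports.
Local Open Scope classical_set_scope.
Local Open Scope ring_scope.

Definition rV_display : measure_display.
Proof. exact: default_measure_display. Qed.

(* The Borel sigma-algebra of R^n, generated by the coordinate functions. *)
Section rV_measurable.
Variables (R : realType) (n : nat).

Definition rV_coord (i : 'I_n) (x : 'rV[R]_n) : measurableTypeR R := x ord0 i.

Let rV_set0 : g_sigma_preimage rV_coord set0.
Proof. exact: sigma_algebra0. Qed.

Let rV_setC A : g_sigma_preimage rV_coord A -> g_sigma_preimage rV_coord (~` A).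
Proof. exact: sigma_algebraC. Qed.

Let rV_bigcup (F : (set 'rV[R]_n)^nat) :
  (forall i, g_sigma_preimage rV_coord (F i)) ->
  g_sigma_preimage rV_coord (\bigcup_i F i).
Proof. exact: sigma_algebra_bigcup. Qed.

HB.instance Definition _ := @isMeasurable.Build rV_display 'rV[R]_n
  (g_sigma_preimage rV_coord) rV_set0 rV_setC rV_bigcup.

End rV_measurable.

(* Lebesgue measure on R^n: the n-fold product of lebesgue_measure, built on
   n-tuples by recursion on n and transported to row vectors. *)
Section lebesgue_rV.
Variable R : realType.
Local Notation RT := (measurableTypeR R).

Definition cons_pair n (xt : RT * n.-tuple RT) : n.+1.-tuple RT :=
  [the n.+1.-tuple RT of xt.1 :: xt.2].

Lemma measurable_cons_pair n : measurable_fun setT (@cons_pair n).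
Proof. exact: measurable_cons. Qed.

Let leb1 : {sigma_finite_measure set RT -> \bar R} :=
  [the {sigma_finite_measure set RT -> \bar R} of @lebesgue_measure R].

Section step.
Variables (n : nat) (mu : {sigma_finite_measure set (n.-tuple RT) -> \bar R}).

Definition lebesgue_step : set (n.+1.-tuple RT) -> \bar R :=
  pushforward (leb1 \x mu)%E (@cons_pair n).

Let step_measure : {measure set (n.+1.-tuple RT) -> \bar R} :=
  measure_function_pushforward__canonical__measure_function_Measure
    (leb1 \x mu)%E (@measurable_cons_pair n).
HB.instance Definition _ := isMeasure.Build _ _ _ lebesgue_step
  (measure0 step_measure) (measure_ge0 step_measure)
  (@measure_semi_sigma_additive _ _ _ step_measure).

Let sf : sigma_finite setT lebesgue_step.
Proof.
have /sigma_finiteP[F [FT ndF Foo]] := sigma_finiteT leb1.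
have /sigma_finiteP[G [GT ndG Goo]] := sigma_finiteT mu.
pose unc (t : n.+1.-tuple RT) : RT * n.-tuple RT := (thead t, [tuple of behead t]).
have munc : measurable_fun setT unc.
  apply: measurable_fun_pair; first exact: measurable_tnth.
  exact: measurable_behead.
have uncK (xt : RT * n.-tuple RT) : unc (cons_pair xt) = xt.
  by case: xt => x t; congr pair => //; exact/val_inj.
exists (fun k => unc @^-1` (F k `*` G k)).
  rewrite -preimage_bigcup (_ : \bigcup_k _ = setT) ?preimage_setT//.
  rewrite -setXTT FT GT predeqE => -[x y]; split.
    by move=> [k _ []/= ? ?]; split; exists k.
  move=> [/= [i _ Fix] [j _ Gjy]]; exists (maxn i j) => //; split.
    by move: x Fix; exact/subsetPset/ndF/leq_maxl.
  by move: y Gjy; exact/subsetPset/ndG/leq_maxr.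
move=> k; have [mF Fk] := Foo k; have [mG Gk] := Goo k.
have mFG : measurable (F k `*` G k) by exact: measurableX.
split; first by rewrite -[X in measurable X]setTI; exact: munc.
rewrite /lebesgue_step /pushforward -comp_preimage (_ : _ \o _ = id); last first.
  by apply/funext => xt /=; rewrite uncK.
by rewrite preimage_id product_measure1E// lte_mul_pinfty// ge0_fin_numE.
Qed.

HB.instance Definition _ := Measure_isSigmaFinite.Build _ _ _ lebesgue_step sf.
End step.

Fixpoint lebesgue_tuple n : {sigma_finite_measure set (n.-tuple RT) -> \bar R} :=
  match n with
  | 0 => [the {sigma_finite_measure set _ -> \bar R} of \d_([tuple] : 0.-tuple RT)]
  | n'.+1 => [the {sigma_finite_measure set _ -> \bar R} of
               lebesgue_step (lebesgue_tuple n')]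
  end.

Definition row_of_tuple n (t : n.-tuple RT) : 'rV[R]_n := \row_i tnth t i.

Lemma measurable_row_of_tuple n : measurable_fun setT (@row_of_tuple n).
Proof.
have h : (fun i => @rV_coord R n i \o @row_of_tuple n) = (fun i t => tnth t i).
  by apply/funext => i; apply/funext => t /=; rewrite /rV_coord mxE.
move=> _ A mA; rewrite setTI.
change (g_sigma_preimage (fun i (t : n.-tuple RT) => tnth t i) (@row_of_tuple n @^-1` A)).
by rewrite -h (g_sigma_preimage_comp (@rV_coord R n)); exists A => //; rewrite setTI.
Qed.

Definition lebesgue_rV n : set 'rV[R]_n -> \bar R :=
  pushforward (lebesgue_tuple n) (@row_of_tuple n).

Let rV_measure n : {measure set 'rV[R]_n -> \bar R} :=
  measure_function_pushforward__canonical__measure_function_Measure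
    (lebesgue_tuple n) (@measurable_row_of_tuple n).
HB.instance Definition _ n := isMeasure.Build _ _ _ (@lebesgue_rV n)
  (measure0 (rV_measure n)) (measure_ge0 (rV_measure n))
  (@measure_semi_sigma_additive _ _ _ (rV_measure n)).
End lebesgue_rV.

Lemma lebesgue_rV_box (R : realType) n (A : 'I_n -> set (measurableTypeR R)) :
  (forall i, measurable (A i)) ->
  lebesgue_rV [set x : 'rV[R]_n | forall i, A i (x ord0 i)] =
  (\prod_i lebesgue_measure (A i))%E.
Proof.
move=> mA; rewrite /lebesgue_rV /pushforward.
rewrite (_ : _ @^-1` _ = [set t : n.-tuple (measurableTypeR R) |
    forall i, A i (tnth t i)]); last first.
  by apply/seteqP; split => t /= h i; have := h i; rewrite /row_of_tuple mxE.
elim: n A mA => [|n IH] A mA.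
  by rewrite big_ord0 /= diracE mem_set//= => -[].
rewrite big_ord_recl -IH//= /lebesgue_step /pushforward.
rewrite -product_measure1E//; last first.
  rewrite (_ : [set t | _] = \bigcap_(i in setT)
      ((fun t : n.-tuple (measurableTypeR R) => tnth t i) @^-1` A (lift ord0 i))); last first.
    by apply/seteqP; split => t /= h i; [move=> _|]; exact: (h i).
  apply: fin_bigcap_measurable => // i _.
  by rewrite -[X in measurable X]setTI; exact: measurable_tnth.
congr (_ _); apply/seteqP; split => -[x t] /=.
  move=> h; split; first by have := h ord0; rewrite tnth0.
  by move=> i; have := h (lift ord0 i); rewrite tnthS.
move=> [Ax At] i; case: (unliftP ord0 i) => [j ->|->]; last by rewrite tnth0.
by rewrite tnthS.
Qed.

Section L2.
Variables (R : realType) (n : nat) (Omega : set 'rV[R]_n).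
Local Notation fn := ('rV[R]_n -> R[i]).
Local Notation mu := (@lebesgue_rV R n).

Definition Refun (f : fn) : 'rV[R]_n -> R := fun x => complex.Re (f x).
Definition Imfun (f : fn) : 'rV[R]_n -> R := fun x => complex.Im (f x).
Definition conjfun (f : fn) : fn := fun x => conjc (f x).
Definition addfun (f g : fn) : fn := fun x => f x + g x.
Definition subfun (f g : fn) : fn := fun x => f x - g x.
Definition scalefun (c : R[i]) (f : fn) : fn := fun x => c * f x.

Definition cintegral (f : fn) : R[i] :=
  Complex (\int[mu]_(x in Omega) Refun f x) (\int[mu]_(x in Omega) Imfun f x).

(* Elements of L^2(Omega) are represented by functions on the whole of R^n of
   which only the values on Omega, up to a null set, matter. *)
Definition aeq (f g : fn) : Prop := f = g %[ae mu in Omega].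

Definition L2 : set fn := [set f |
  [/\ measurable_fun Omega (Refun f), measurable_fun Omega (Imfun f) &
      (\int[mu]_(x in Omega) (Normc.normc (f x) ^+ 2)%:E < +oo)%E]].

Definition inner (f g : fn) : R[i] := cintegral (fun x => f x * conjc (g x)).

Definition L2norm (f : fn) : R :=
  Num.sqrt (\int[mu]_(x in Omega) (Normc.normc (f x) ^+ 2)).

End L2.

Section differential_operators.
Variables (R : realType) (n m : nat) (Omega : set 'rV[R]_n).
Local Notation fn := ('rV[R]_n -> R[i]).

Definition partial (i : 'I_n) (f : fn) : fn :=
  fun x => Complex ('D_('e_i) (Refun f) x) ('D_('e_i) (Imfun f) x).

Definition partials (s : seq 'I_n) (f : fn) : fn := foldr partial f s.

Definition smooth_on (U : set 'rV[R]_n) (f : fn) : Prop :=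
  forall (s : seq 'I_n) (x : 'rV[R]_n), U x ->
    [/\ {for x, continuous (Refun (partials s f))},
        {for x, continuous (Imfun (partials s f))},
        forall i, derivable (Refun (partials s f)) x 'e_i &
        forall i, derivable (Imfun (partials s f)) x 'e_i].

(* C_c^oo(Omega) *)
Definition bump : set fn := [set phi | smooth_on setT phi /\
  exists K, [/\ compact K, K `<=` Omega & forall x, ~ K x -> phi x = 0]].

(* Multi-indices; those of length at most m have all entries at most m. *)
Definition multi_index := {ffun 'I_n -> 'I_m.+1}.
Definition mlen (al : multi_index) : nat := (\sum_i al i)%N.
Definition mpartial (al : multi_index) : fn -> fn :=
  partials (flatten [seq nseq (al i) i | i <- enum 'I_n]).

(* The coefficients of sum_(|al| <= m) a_al D^al; the values of a at
   multi-indices of length > m are never used. *)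
Variable a : multi_index -> fn.

(* The formal transpose sum_(|al| <= m) (-1)^|al| D^al (a_al .). *)
Definition transpose (phi : fn) : fn := fun x =>
  \sum_(al : multi_index | (mlen al <= m)%N)
    (-1) ^+ mlen al * mpartial al (fun y => a al y * phi y) x.

(* sum_(|al| <= m) a_al D^al f = g in the sense of distributions on Omega *)
Definition diffop_weak (f g : fn) : Prop := forall phi, bump phi ->
  cintegral Omega (fun x => f x * transpose phi x) =
  cintegral Omega (fun x => g x * phi x).

(* The L^2 realisation of the differential operator with boundary conditions
   BC, as a graph: its domain consists of the f in L^2(Omega) that satisfy BC
   and are mapped into L^2(Omega). *)
Definition realization (BC : set fn) (f g : fn) : Prop :=
  [/\ L2 Omega f, L2 Omega g, BC f & diffop_weak f g].

End differential_operators.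

(* Unbounded operators on L^2(Omega) are given by their graphs T f g, meaning
   "f is in Dom(T) and T f = g almost everywhere on Omega". *)
Section operators.
Variables (R : realType) (n : nat) (Omega : set 'rV[R]_n).
Local Notation fn := ('rV[R]_n -> R[i]).
Local Notation operator := (fn -> fn -> Prop).

(* This is the graph of a function only when dom T is dense. *)
Definition adjoint (T : operator) : operator := fun f g =>
  [/\ L2 Omega f, L2 Omega g &
      forall h k, T h k -> inner Omega k f = inner Omega h g].

Definition resolvent_set (T : operator) : set R[i] := [set z |
  (forall f h, T f h -> aeq Omega h (scalefun z f) ->
     aeq Omega f (fun=> 0)) /\
  exists B : R, forall g, L2 Omega g -> exists f h,
    [/\ T f h, aeq Omega (subfun h (scalefun z f)) g &
        L2norm Omega f <= B * L2norm Omega g]].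

Definition spectrum (T : operator) : set R[i] := ~` resolvent_set T.

Variable T : operator.

Definition dom : set fn := [set f | exists g, T f g].

(* A representative of T f, for f in the domain. *)
Definition app (f : fn) : fn := xget (fun=> 0) [set g | T f g].

Definition dom_pow (k : nat) : set fn := [set f | L2 Omega f /\
  forall j, (j < k)%N -> dom (iter j app f)].

Definition Hinf : set fn := \bigcap_(k in [set k | (1 <= k)%N]) dom_pow k.

Definition seminorm (k : nat) (f : fn) : R :=
  \big[Num.max/0]_(j < k.+1) L2norm Omega (iter j app f).

Definition Hinf_complete : Prop :=
  forall phi : nat -> fn, (forall i, Hinf (phi i)) ->
    (forall k (eps : R), 0 < eps -> exists N, forall i j, (N <= i)%N ->
       (N <= j)%N -> seminorm k (subfun (phi i) (phi j)) < eps) ->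
    exists2 f, Hinf f & forall k (eps : R), 0 < eps ->
      exists N, forall i, (N <= i)%N -> seminorm k (subfun (phi i) f) < eps.

Definition conj_stable : Prop := forall f, Hinf f -> Hinf (conjfun f).

Definition continuous_linear_op (A : fn -> fn) : Prop :=
  [/\ forall f, Hinf f -> Hinf (A f),
      forall c f g, Hinf f -> Hinf g ->
        aeq Omega (A (addfun (scalefun c f) g))
                  (addfun (scalefun c (A f)) (A g)) &
      forall f, Hinf f -> forall k (eps : R), 0 < eps ->
        exists k' (delta : R), 0 < delta /\ forall g, Hinf g ->
          seminorm k' (subfun g f) < delta ->
          seminorm k (subfun (A g) (A f)) < eps].

Definition continuous_linear_form (w : fn -> R[i]) : Prop :=
  (forall c f g, Hinf f -> Hinf g ->
     w (addfun (scalefun c f) g) = c * w f + w g) /\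
  (forall f, Hinf f -> forall eps : R, 0 < eps ->
     exists k (delta : R), 0 < delta /\ forall g, Hinf g ->
       seminorm k (subfun g f) < delta -> Normc.normc (w g - w f) < eps).

End operators.

Section families.
Variables (R : realType) (n : nat) (Omega : set 'rV[R]_n).
Local Notation fn := ('rV[R]_n -> R[i]).
Variables (I : choiceType).

(* Unconditional convergence in L^2(Omega) of sum_xi c_xi u_xi to f. *)
Definition has_L2sum (u : I -> fn) (c : I -> R[i]) (f : fn) : Prop :=
  forall eps : R, 0 < eps -> exists F0 : {fset I}, forall F : {fset I},
    (F0 `<=` F)%fset ->
    L2norm Omega (subfun f (fun x => \sum_(xi <- F) c xi * u xi x)) < eps.

Definition is_basis (u : I -> fn) : Prop :=
  (forall xi, L2 Omega (u xi)) /\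
  forall f, L2 Omega f -> exists! c : I -> R[i], has_L2sum u c f.

Definition norm_equivalent (u : I -> fn) : Prop :=
  exists c C : R, [/\ 0 < c, 0 < C & forall f, L2 Omega f ->
    ((c * L2norm Omega f ^+ 2)%:E <=
       \esum_(xi in [set: I]) (Normc.normc (inner Omega f (u xi)) ^+ 2)%:E <=
     (C * L2norm Omega f ^+ 2)%:E)%E].

(* S(I) and S'(I) for the weight br *)
Definition rapidly_decreasing (br : I -> R) : set (I -> R[i]) := [set phi |
  forall M : R, 0 < M -> exists C : R,
    forall xi, Normc.normc (phi xi) <= C * br xi `^ (- M)].

Definition slowly_growing (br : I -> R) : set (I -> R[i]) := [set phi |
  exists C M : R, [/\ 0 < C, 0 < M &
    forall xi, Normc.normc (phi xi) <= C * br xi `^ M]].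

End families.

Definition znorm (R : realType) (K : nat) (xi : 'rV[int]_K) : R :=
  Num.sqrt (\sum_i (xi ord0 i)%:~R ^+ 2).

Section fourier.
Variables (R : realType) (n : nat) (Omega : set 'rV[R]_n).
Local Notation fn := ('rV[R]_n -> R[i]).
Local Notation operator := (fn -> fn -> Prop).
Variables (I : choiceType) (L : operator) (v : I -> fn) (br : I -> R).
Local Notation Ls := (adjoint Omega L).

Definition fourier (f : fn) : I -> R[i] := fun xi => inner Omega f (v xi).

Definition fourier_dist (w : fn -> R[i]) : I -> R[i] :=
  fun xi => w (conjfun (v xi)).

(* H^{-oo}_L: functionals on H^oo_{L*}. A functional is represented by a map
   on all functions, of which only the values on H^oo_{L*} matter. *)
Definition distribution (w : fn -> R[i]) : Prop :=
  continuous_linear_form Omega Ls w.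

Definition deq (w w' : fn -> R[i]) : Prop :=
  forall phi, Hinf Omega Ls phi -> w phi = w' phi.

Definition embed (f : fn) : fn -> R[i] :=
  fun phi => cintegral Omega (fun x => f x * phi x).

Definition in_Hinf (w : fn -> R[i]) : Prop :=
  exists2 f, Hinf Omega L f & deq w (embed f).

(* H^oo_L -> S(I) is a bijection, continuous with continuous inverse, where
   S(I) has the seminorms sup_xi br(xi)^N |phi(xi)| *)
Definition fourier_homeomorphism : Prop :=
  [/\ forall f, Hinf Omega L f -> rapidly_decreasing br (fourier f),
      forall f g, Hinf Omega L f -> Hinf Omega L g -> fourier f = fourier g ->
        aeq Omega f g,
      forall phi, rapidly_decreasing br phi ->
        exists2 f, Hinf Omega L f & fourier f = phi,
      forall f, Hinf Omega L f -> forall (N : nat) (eps : R), 0 < eps ->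
        exists k (delta : R), 0 < delta /\ forall g, Hinf Omega L g ->
          seminorm Omega L k (subfun g f) < delta -> forall xi,
          br xi ^+ N * Normc.normc (fourier g xi - fourier f xi) <= eps &
      forall f, Hinf Omega L f -> forall k (eps : R), 0 < eps ->
        exists (N : nat) (delta : R), 0 < delta /\ forall g, Hinf Omega L g ->
          (forall xi,
             br xi ^+ N * Normc.normc (fourier g xi - fourier f xi) <= delta) ->
          seminorm Omega L k (subfun g f) < eps].

Definition fourier_dist_bijection : Prop :=
  [/\ forall w, distribution w -> slowly_growing br (fourier_dist w),
      forall w w', distribution w -> distribution w' ->
        fourier_dist w = fourier_dist w' -> deq w w' &
      forall phi, slowly_growing br phi ->
        exists2 w, distribution w & fourier_dist w = phi].

Definition fourier_multiplier (A : fn -> fn) (sigma : I -> R[i]) : Prop :=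
  continuous_linear_op Omega L A /\
  forall f, Hinf Omega L f ->
    forall xi, fourier (A f) xi = sigma xi * fourier f xi.

(* As : H^oo_{L*} -> H^oo_{L*} is the L^2-adjoint of A : H^oo_L -> H^oo_L *)
Definition is_L2_adjoint (A As : fn -> fn) : Prop :=
  (forall g, Hinf Omega Ls g -> Hinf Omega Ls (As g)) /\
  forall f g, Hinf Omega L f -> Hinf Omega Ls g ->
    inner Omega (A f) g = inner Omega f (As g).

(* The extension to distributions of the operator with L^2-adjoint As. *)
Definition dist_extension (As : fn -> fn) (w : fn -> R[i]) : fn -> R[i] :=
  fun phi => w (conjfun (As (conjfun phi))).

Definition globally_hypoelliptic (P : (fn -> R[i]) -> (fn -> R[i])) : Prop :=
  forall w, distribution w -> in_Hinf (P w) -> in_Hinf w.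

End fourier.

(* The boundary conditions are an arbitrary linear space BC of (classes of)
   functions; the conjugate conditions are those contained in the domain of the
   Hilbert space adjoint. *)
Record setting (R : realType) (n m K : nat) := Setting {
  Omega : set 'rV[R]_n;
  coef : multi_index n m -> 'rV[R]_n -> R[i];
  BC : set ('rV[R]_n -> R[i]);
  idx : set 'rV[int]_K;
  lam : idx -> R[i];
  u : idx -> 'rV[R]_n -> R[i];
  v : idx -> 'rV[R]_n -> R[i];

  L := realization Omega coef BC;
  Lstar := adjoint Omega L;
  bracket : idx -> R :=
    fun xi => (1 + Normc.normc (lam xi) ^+ 2) `^ (2 * m%:R)^-1;

  Omega_open : open Omega;
  Omega_bounded : bounded_set Omega;
  coef_smooth : forall al, (mlen al <= m)%N -> smooth_on Omega (coef al);
  order_gt0 : (0 < m)%N;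
  order_eq : exists al x, [/\ mlen al = m, Omega x & coef al x != 0];
  BC_aeq : forall f g, aeq Omega f g -> BC f -> BC g;
  BC0 : BC (fun=> 0);
  BC_linear : forall c f g, BC f -> BC g -> BC (addfun (scalefun c f) g);

  K_gt0 : (0 < K)%N;
  L_spectrum : spectrum Omega L = range lam;
  lam_infty : forall B : R, exists N : R, forall xi : idx,
    N <= znorm R (val xi) -> B <= Normc.normc (lam xi);
  lam_mono : forall j k : idx, znorm R (val j) <= znorm R (val k) ->
    Normc.normc (lam j) <= Normc.normc (lam k);

  u_eigen : forall xi, L (u xi) (scalefun (lam xi) (u xi));
  v_eigen : forall xi, Lstar (v xi) (scalefun (conjc (lam xi)) (v xi));
  biorthogonal : forall xi eta, inner Omega (u xi) (v eta) = (xi == eta)%:R;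
  u_basis : is_basis Omega u;
  v_norm_equivalent : norm_equivalent Omega v;
  u_norm_equivalent : norm_equivalent Omega u;

  L_complete : Hinf_complete Omega L;
  Lstar_complete : Hinf_complete Omega Lstar;
  L_conj_stable : conj_stable Omega L;
  Lstar_conj_stable : conj_stable Omega Lstar;

  fourier_Hinf : fourier_homeomorphism Omega L v bracket;
  fourier_distributions : fourier_dist_bijection Omega L v bracket
}.

Arguments lam {R n m K} s _.
Arguments u {R n m K} s _ _.
Arguments v {R n m K} s _ _.
Arguments bracket {R n m K} s _.

(* Main.v *)
Require Import Defs.
From HB Require Import structures.
From mathcomp Require Import all_boot all_order all_algebra.
From mathcomp Require Import finmap complex.
From mathcomp Require Import all_classical all_reals all_analysis.
From mathcomp Require Import measurable_realfun ring lra.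
Set Implicit Arguments. Unset Strict Implicit. Unset Printing Implicit Defensive.
Import Order.TTheory GRing.Theory Num.Theory.
Import numFieldNormedType.Exports.
Local Open Scope classical_set_scope.
Local Open Scope ring_scope.

(** On the Fourier side P multiplies coefficients by sigma, both for test functions
    and, through the adjoint, for distributions (fourier_extension). A distribution
    is given by a test function exactly when its coefficients decrease rapidly
    (in_Hinf_rapidly_decreasing, rapidly_decreasing_in_Hinf). So the theorem is about
    sequences: division by sigma preserves rapid decrease, among sequences of
    moderate growth, if and only if sigma is bounded below by a negative power of the
    bracket for large brackets.

    If the lower bound holds, dividing by sigma loses a power of the bracket, which
    rapid decrease absorbs (lower_bound_hypoelliptic).

    If it fails, there are indices x_k with bracket at least 4^k at which
    |sigma| <= bracket^(- 4^k). Let e_k be the test function whose coefficients are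
    1 at x_k and 0 elsewhere. The sum w of the 2^-k e_k is not smooth, but P w is
    (hypoelliptic_lower_bound). The summable weights, rather than weights 1, make w
    a functional bounded in L2; so is P w, which pairs with a test function as the
    sum of the 2^-k P e_k (extension_series_form). Thus P w is computed on every
    test function from its definition, by moving the adjoint of P inside the sum, and
    is seen to be a distribution with rapidly decreasing coefficients.

    Test functions are represented pointwise while operators, norms and pairings
    only determine them up to null sets. The part on linear graphs shows that
    iterates, seminorms and distributions are insensitive to the representative; it
    rests on the single-valuedness of the adjoint of L, which holds because the
    eigenfunctions of L are total. *)

(** * Open sets are Borel *)

Section openset.
Variables (R : realType) (n : nat).

Lemma measurable_rV_coord (i : 'I_n) : measurable_fun setT (@rV_coord R n i).
Proof.
move=> _ B mB; rewrite setTI; apply: sub_sigma_algebra.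
rewrite -bigcup_seq; exists i => /=; first by rewrite mem_index_enum.
by exists B => //; rewrite setTI.
Qed.

(** The sup-norm topology of row vectors has a countable base of rational
    boxes, each of them a finite intersection of coordinate preimages. Without
    it the measurability clauses in the definition of L2 would carry no
    information, as measurability on Omega presupposes that of Omega. *)
Lemma open_measurable_rV (U : set 'rV[R]_n) : open U -> measurable U.
Proof.
move=> oU.
pose box (q : 'rV[rat]_n * rat) : set 'rV[R]_n :=
  [set x | forall i, `|x ord0 i - ratr (q.1 ord0 i)| < ratr q.2].
have mbox q : measurable (box q).
  rewrite (_ : box q = \bigcap_(i in [set: 'I_n])
     (@rV_coord R n i @^-1` ball (ratr (q.1 ord0 i) : R) (ratr q.2))); last first.
    apply/seteqP; split => x /= h i; first by move=> _; rewrite /ball/= distrC; exact: h.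
    by have := h i I; rewrite /ball /= distrC.
  apply: fin_bigcap_measurable => // i _; rewrite -[X in measurable X]setTI.
  by apply: measurable_rV_coord => //; exact: measurable_ball.
pose F (k : nat) : set 'rV[R]_n :=
  if (choice.unpickle k : option ('rV[rat]_n * rat)%type) is Some q then
    (if `[< box q `<=` U >] then box q else set0) else set0.
rewrite (_ : U = \bigcup_k F k); last first.
  apply/seteqP; split => x; last first.
    rewrite /F => -[k _]; case: choice.unpickle => // q; case: ifP => // /asboolP; exact.
  move=> Ux; have /nbhs_ballP[e /= e0 xeU] : nbhs x U by exact: open_nbhs_nbhs.
  have [r re] : exists r : rat, ratr r \in `]0, (e / 2)[.
    by have [r] := @rat_in_itvoo R 0 (e / 2) ltac:(by rewrite divr_gt0); exists r.
  rewrite in_itv /= in re; case/andP: re => r0 re.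
  have hq i : exists q : rat, ratr q \in `](x ord0 i - ratr r), (x ord0 i + ratr r)[.
    have [|q] := @rat_in_itvoo R (x ord0 i - ratr r) (x ord0 i + ratr r); last by exists q.
    by rewrite ltrBlDr -addrA ltrDl addr_gt0.
  pose q : 'rV[rat]_n := \row_i sval (cid (hq i)).
  have xq i : `|x ord0 i - ratr (q ord0 i)| < ratr r.
    rewrite /q mxE; case: cid => s /=; rewrite in_itv /= ltr_norml => /andP[h1 h2].
    by apply/andP; split; lra.
  exists (choice.pickle (q, r)) => //; rewrite /F choice.pickleK asboolT //.
  move=> y yb; apply: xeU; split => [|i j]; [by []|rewrite ord1]; rewrite /ball /=.
  have := yb j; have := xq j => /=; rewrite !ltr_norml => /andP[? ?] /andP[? ?].
  by apply/andP; split; lra.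
apply: bigcupT_measurable => k; rewrite /F; case: choice.unpickle => // q.
by case: ifP.
Qed.
End openset.

(** * Square integrable functions *)

Lemma normc_sqr (R : rcfType) (z : R[i]) :
  Normc.normc z ^+ 2 = complex.Re z ^+ 2 + complex.Im z ^+ 2.
Proof. by case: z => a b /=; rewrite sqr_sqrtr // addr_ge0 ?sqr_ge0. Qed.

Lemma normc_ge0 (R : rcfType) (z : R[i]) : 0 <= Normc.normc z.
Proof. by case: z => a b /=; exact: sqrtr_ge0. Qed.

Lemma normc_nat_bool (R : rcfType) (b : bool) : Normc.normc (b%:R : R[i]) = b%:R.
Proof. by case: b; rewrite ?Normc.normc1 ?Normc.normc0. Qed.

Lemma normc_le_ReIm (R : rcfType) (z : R[i]) :
  Normc.normc z <= `|complex.Re z| + `|complex.Im z|.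
Proof.
rewrite -[leRHS]ger0_norm ?addr_ge0 // -[leLHS]ger0_norm ?normc_ge0 //.
rewrite -ler_sqr ?nnegrE ?normr_ge0 //.
rewrite !real_normK ?num_real // normc_sqr sqrrD !real_normK ?num_real //.
by rewrite addrAC lerDl mulrn_wge0 // mulr_ge0.
Qed.

Lemma normr_Re_le (R : rcfType) (z : R[i]) : `|complex.Re z| <= Normc.normc z.
Proof.
rewrite -[leRHS]ger0_norm ?normc_ge0 // -ler_sqr ?nnegrE ?normr_ge0 //.
by rewrite !real_normK ?num_real // normc_sqr lerDl sqr_ge0.
Qed.

Lemma normr_Im_le (R : rcfType) (z : R[i]) : `|complex.Im z| <= Normc.normc z.
Proof.
rewrite -[leRHS]ger0_norm ?normc_ge0 // -ler_sqr ?nnegrE ?normr_ge0 //.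
by rewrite !real_normK ?num_real // normc_sqr lerDr sqr_ge0.
Qed.

Lemma normr_Re_mul_le (R : realType) (z w : R[i]) : `|complex.Re (z * w)| <=
  Normc.normc z ^+ 2 + Normc.normc w ^+ 2.
Proof.
rewrite !normc_sqr; case: z w => [a b] [c d] /=; rewrite ler_norml.
have := sqr_ge0 (a + c); have := sqr_ge0 (a - c).
have := sqr_ge0 (b + d); have := sqr_ge0 (b - d).
rewrite !expr2 => *; apply/andP; split; nra.
Qed.

Lemma normr_Im_mul_le (R : realType) (z w : R[i]) : `|complex.Im (z * w)| <=
  Normc.normc z ^+ 2 + Normc.normc w ^+ 2.
Proof.
rewrite !normc_sqr; case: z w => [a b] [c d] /=; rewrite ler_norml.
have := sqr_ge0 (a + d); have := sqr_ge0 (a - d).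
have := sqr_ge0 (b + c); have := sqr_ge0 (b - c).
rewrite !expr2 => *; apply/andP; split; nra.
Qed.

Section square_integrable.
Variables (R : realType) (n : nat) (Omega : set 'rV[R]_n).
Local Notation fn := ('rV[R]_n -> R[i]).
Local Notation mu := (@lebesgue_rV R n).
Local Notation nsq f := (fun x => Normc.normc (f x) ^+ 2).

Definition cmeasurable (f : fn) :=
  measurable_fun Omega (Refun f) /\ measurable_fun Omega (Imfun f).

Definition cintegrable (f : fn) :=
  mu.-integrable Omega (EFin \o Refun f) /\
  mu.-integrable Omega (EFin \o Imfun f).

Lemma cmeasurableM (f g : fn) : cmeasurable f -> cmeasurable g ->
  cmeasurable (fun x => f x * g x).
Proof.
move=> [fr fi] [gr gi]; split.
  rewrite (_ : Refun _ = (Refun f \* Refun g) \- (Imfun f \* Imfun g)).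
    by apply: measurable_funB; apply: measurable_funM.
  by apply/funext => x; rewrite /Refun /Imfun /=; case: (f x) (g x) => [? ?] [? ?].
rewrite (_ : Imfun _ = (Refun f \* Imfun g) \+ (Imfun f \* Refun g)).
  by apply: measurable_funD; apply: measurable_funM.
by apply/funext => x; rewrite /Refun /Imfun /=; case: (f x) (g x) => [? ?] [? ?].
Qed.

Lemma cmeasurable_lin c (f g : fn) : cmeasurable f -> cmeasurable g ->
  cmeasurable (addfun (scalefun c f) g).
Proof.
move=> mf [gr gi]; have [] := @cmeasurableM (fun=> c) f _ mf.
  by split; exact: measurable_cst.
move=> hr hi; split.
  rewrite (_ : Refun _ = Refun (fun x => c * f x) \+ Refun g).
    exact: measurable_funD.
  apply/funext => x; rewrite /Refun /addfun /scalefun /=.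
  by case: (c * f x) (g x) => [? ?] [? ?].
rewrite (_ : Imfun _ = Imfun (fun x => c * f x) \+ Imfun g).
  exact: measurable_funD.
apply/funext => x; rewrite /Imfun /addfun /scalefun /=.
by case: (c * f x) (g x) => [? ?] [? ?].
Qed.

Lemma Refun_conj (f : fn) : Refun (conjfun f) = Refun f.
Proof. by apply/funext => x; rewrite /Refun /conjfun; case: (f x). Qed.

Lemma Imfun_conj (f : fn) : Imfun (conjfun f) = \- Imfun f.
Proof. by apply/funext => x; rewrite /Imfun /conjfun /=; case: (f x). Qed.

Lemma conjfunK (f : fn) : conjfun (conjfun f) = f.
Proof. by apply/funext => x; rewrite /conjfun conjcK. Qed.

Lemma cmeasurable_conj (f : fn) : cmeasurable f -> cmeasurable (conjfun f).
Proof.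
move=> [fr fi]; split; rewrite ?Refun_conj // Imfun_conj.
exact: measurableT_comp.
Qed.

Lemma aeq_refl (f : fn) : aeq Omega f f. Proof. exact: aeW. Qed.

Lemma aeq_sym (f g : fn) : aeq Omega f g -> aeq Omega g f.
Proof. by apply: filterS => x h /h. Qed.

Lemma aeq_comp2 (j : R[i] -> R[i] -> R[i]) (f f' g g' : fn) :
  aeq Omega f f' -> aeq Omega g g' ->
  aeq Omega (fun x => j (f x) (g x)) (fun x => j (f' x) (g' x)).
Proof. by apply: filterS2 => x + + Ox => /(_ Ox) -> /(_ Ox) ->. Qed.

Hypothesis mO : measurable Omega.

Lemma measurable_nsq (f : fn) : cmeasurable f -> measurable_fun Omega (nsq f).
Proof.
move=> [fr fi]; rewrite (_ : nsq f = fun x => Refun f x ^+ 2 + Imfun f x ^+ 2).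
  by apply: measurable_funD; exact: measurable_funX.
by apply/funext => x; exact: normc_sqr.
Qed.

Lemma L2_cmeasurable f : L2 Omega f -> cmeasurable f.
Proof. by case. Qed.

Lemma L2_integrable f : L2 Omega f ->
  mu.-integrable Omega (EFin \o nsq f).
Proof.
move=> [fr fi foo]; apply/integrableP; split.
  by apply/measurable_EFinP; apply: measurable_nsq; split.
rewrite (_ : (fun x => _) = EFin \o nsq f) //.
by apply/funext => x /=; rewrite ger0_norm ?exprn_ge0 ?normc_ge0.
Qed.

(** The one comparison argument behind the stability of L2: both summands of
    the bound are integrable, hence so is what they dominate. *)
Lemma L2_dominated (f g h : fn) (a : R) : cmeasurable f -> L2 Omega g ->
  L2 Omega h -> (forall x, Omega x ->
    Normc.normc (f x) ^+ 2 <= a * Normc.normc (g x) ^+ 2 + a * Normc.normc (h x) ^+ 2) ->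
  L2 Omega f.
Proof.
move=> mf g2 h2 fgh; case: (mf) => fr fi; split => //.
have ig : mu.-integrable Omega (fun x => a%:E * (nsq g x)%:E)%E.
  by apply: integrableZl => //; exact: L2_integrable.
have ih : mu.-integrable Omega (fun x => a%:E * (nsq h x)%:E)%E.
  by apply: integrableZl => //; exact: L2_integrable.
have igh := integrableD mO ig ih.
apply: (@le_lt_trans _ _ (\int[mu]_(x in Omega)
  (a%:E * (nsq g x)%:E + a%:E * (nsq h x)%:E))%E); last exact: (integrable_lty mO igh).
apply: ge0_le_integral => //.
- by move=> x _; rewrite lee_fin sqr_ge0.
- by apply/measurable_EFinP; exact: measurable_nsq.
- exact: (measurable_int _ igh).
Qed.

Lemma L2_lin c f g : L2 Omega f -> L2 Omega g ->
  L2 Omega (addfun (scalefun c f) g).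
Proof.
move=> f2 g2; apply: (@L2_dominated _ f g (2 * Normc.normc c ^+ 2 + 2)) => //.
  by apply: cmeasurable_lin; exact: L2_cmeasurable.
move=> x _; rewrite /addfun /scalefun.
have : Normc.normc (c * f x + g x) <=
    Normc.normc c * Normc.normc (f x) + Normc.normc (g x).
  by apply: le_trans (le_normcD _ _) _; rewrite Normc.normcM.
move: (normc_ge0 (c * f x + g x)) (normc_ge0 (f x)) (normc_ge0 (g x)) (normc_ge0 c).
move: (Normc.normc _) (Normc.normc c) (Normc.normc (f x)) (Normc.normc (g x)).
move=> y r s t y0 s0 t0 r0 yle.
have : y ^+ 2 <= (r * s + t) ^+ 2 by rewrite ler_sqr ?nnegrE ?addr_ge0 ?mulr_ge0.
move=> /le_trans; apply.
have := sqr_ge0 (r * s - t); have := sqr_ge0 s; have := sqr_ge0 (r * t).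
by nra.
Qed.

Lemma L2_conj f : L2 Omega f -> L2 Omega (conjfun f).
Proof.
move=> f2; apply: (@L2_dominated _ f f 1) => //.
  exact/cmeasurable_conj/L2_cmeasurable.
by move=> x _; rewrite !normc_sqr /conjfun; case: (f x) => a b /=; nra.
Qed.

Lemma L2_0 : L2 Omega (fun=> 0).
Proof.
split; try exact: measurable_cst.
rewrite (_ : (\int[_]_(x in _) _)%E = 0%E) //.
by apply: integral0_eq => x _; rewrite Normc.normc0 expr0n.
Qed.

End square_integrable.

(** * The inner product *)

Section inner_product.
Variables (R : realType) (n : nat) (Omega : set 'rV[R]_n).
Hypothesis mO : measurable Omega.
Local Notation fn := ('rV[R]_n -> R[i]).
Local Notation mu := (@lebesgue_rV R n).
Local Notation nsq f := (fun x => Normc.normc (f x) ^+ 2).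

Lemma L2_mul_cintegrable (f g : fn) : L2 Omega f -> L2 Omega g ->
  cintegrable Omega (fun x => f x * g x).
Proof.
move=> f2 g2.
have [mr mi] := cmeasurableM (L2_cmeasurable f2) (L2_cmeasurable g2).
have ifg := integrableD mO (L2_integrable f2) (L2_integrable g2).
split; apply: (le_integrable mO _ _ ifg); try exact/measurable_EFinP.
  move=> x Ox /=; rewrite lee_fin [leRHS]ger0_norm ?addr_ge0 ?sqr_ge0 //.
  exact: normr_Re_mul_le.
move=> x Ox /=; rewrite lee_fin [leRHS]ger0_norm ?addr_ge0 ?sqr_ge0 //.
exact: normr_Im_mul_le.
Qed.

Lemma cintegral_lin c (f g : fn) : cintegrable Omega f -> cintegrable Omega g ->
  cintegral Omega (addfun (scalefun c f) g) =
  c * cintegral Omega f + cintegral Omega g.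
Proof.
move=> [fr fi] [gr gi]; case: c => a b; rewrite /cintegral.
have iZ (r : R) (h : _ -> R) : mu.-integrable Omega (EFin \o h) ->
    mu.-integrable Omega (EFin \o (fun x => r * h x)).
  exact: integrableZl.
have iD (h k : _ -> R) : mu.-integrable Omega (EFin \o h) ->
    mu.-integrable Omega (EFin \o k) ->
    mu.-integrable Omega (EFin \o (fun x => h x + k x)).
  exact: integrableD.
have -> : Refun (addfun (scalefun (Complex a b) f) g) =
    fun x => (a * Refun f x + (- b) * Imfun f x) + Refun g x.
  apply/funext => x; rewrite /Refun /Imfun /addfun /scalefun.
  by case: (f x) (g x) => [? ?] [? ?] /=; rewrite mulNr.
have -> : Imfun (addfun (scalefun (Complex a b) f) g) =
    fun x => (a * Imfun f x + b * Refun f x) + Imfun g x.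
  apply/funext => x; rewrite /Refun /Imfun /addfun /scalefun.
  by case: (f x) (g x) => [? ?] [? ?].
rewrite !(RintegralD mO) ?(RintegralZl _ mO); auto.
by rewrite /= mulNr.
Qed.

Lemma cintegral_conj (f : fn) : cintegrable Omega f ->
  cintegral Omega (conjfun f) = conjc (cintegral Omega f).
Proof.
move=> [fr fi]; rewrite /cintegral Refun_conj Imfun_conj /=; congr Complex.
under eq_Rintegral do rewrite -mulN1r.
by rewrite RintegralZl // mulN1r.
Qed.

Lemma aeq_cintegral (f g : fn) : cmeasurable Omega f -> cmeasurable Omega g ->
  aeq Omega f g -> cintegral Omega f = cintegral Omega g.
Proof.
move=> [fr fi] [gr gi] fg; rewrite /cintegral /Rintegral.
congr (Complex (fine _) (fine _)); apply: ae_eq_integral => //;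
  try exact/measurable_EFinP.
- by apply: filterS fg => x h Ox /=; rewrite /Refun h.
- by apply: filterS fg => x h Ox /=; rewrite /Imfun h.
Qed.

Lemma L2norm_ge0 (f : fn) : 0 <= L2norm Omega f.
Proof. exact: sqrtr_ge0. Qed.

Lemma L2norm_sqr (f : fn) : L2norm Omega f ^+ 2 = \int[mu]_(x in Omega) nsq f x.
Proof. by rewrite sqr_sqrtr // Rintegral_ge0 // => x _; rewrite sqr_ge0. Qed.

Lemma L2norm_eq0 (f : fn) : L2 Omega f -> L2norm Omega f = 0 ->
  aeq Omega f (fun=> 0).
Proof.
move=> f2 /(congr1 (fun r => r ^+ 2)); rewrite L2norm_sqr expr0n /= => f0.
have fi := L2_integrable f2.
have h : (\int[mu]_(x in Omega) `|(nsq f x)%:E|)%E = 0%E.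
  under eq_integral do rewrite gee0_abs ?lee_fin ?sqr_ge0 //.
  have := integrable_fin_num mO fi => /fineK <-.
  by rewrite -[X in X%:E]/(Rintegral mu Omega (nsq f)) f0.
have /(ae_eq_integral_abs mu mO) : measurable_fun Omega (EFin \o nsq f).
  exact: measurable_int fi.
move=> [/(_ h) + _]; apply: filterS => x /[apply] /= -[] /eqP.
by rewrite expf_eq0 /= => /eqP /Normc.eq0_normc.
Qed.

Lemma aeq0_L2norm (f : fn) : L2 Omega f -> aeq Omega f (fun=> 0) ->
  L2norm Omega f = 0.
Proof.
move=> f2 f0; apply/eqP; rewrite -sqrf_eq0 L2norm_sqr /Rintegral.
rewrite (_ : (\int[mu]_(x in Omega) _)%E = (\int[mu]_(x in Omega) 0)%E).
  by rewrite integral0.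
apply: ae_eq_integral => //; first exact: measurable_int (L2_integrable f2).
by apply: filterS f0 => x /[apply] ->; rewrite Normc.normc0 expr0n.
Qed.

Lemma inner_lin c (f g k : fn) : L2 Omega f -> L2 Omega g -> L2 Omega k ->
  inner Omega (addfun (scalefun c f) g) k = c * inner Omega f k + inner Omega g k.
Proof.
move=> f2 g2 k2; rewrite /inner -cintegral_lin; first last.
- exact: L2_mul_cintegrable g2 (L2_conj mO k2).
- exact: L2_mul_cintegrable f2 (L2_conj mO k2).
- congr cintegral; apply/funext => x.
  by rewrite /addfun /scalefun mulrDl mulrA.
Qed.

Lemma inner_conj (f g : fn) : L2 Omega f -> L2 Omega g ->
  inner Omega g f = conjc (inner Omega f g).
Proof.
move=> f2 g2; rewrite /inner -cintegral_conj; last first.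
  exact: L2_mul_cintegrable f2 (L2_conj mO g2).
by congr cintegral; apply/funext => x; rewrite /conjfun rmorphM /= conjcK mulrC.
Qed.

Lemma inner_aeq (f f' g g' : fn) : L2 Omega f -> L2 Omega f' ->
  L2 Omega g -> L2 Omega g' -> aeq Omega f f' -> aeq Omega g g' ->
  inner Omega f g = inner Omega f' g'.
Proof.
move=> f2 f2' g2 g2' ff gg; apply: aeq_cintegral.
- exact: cmeasurableM (L2_cmeasurable f2) (L2_cmeasurable (L2_conj mO g2)).
- exact: cmeasurableM (L2_cmeasurable f2') (L2_cmeasurable (L2_conj mO g2')).
- exact: (aeq_comp2 (fun a b => a * conjc b)).
Qed.

Lemma inner_0l (g : fn) : L2 Omega g -> inner Omega (fun=> 0) g = 0.
Proof.
move=> g2; have := inner_lin (- 1) (L2_0 Omega) (L2_0 Omega) g2.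
rewrite mulN1r addNr => E; rewrite -[RHS]E; congr inner; apply/funext => x.
by rewrite /addfun /scalefun mulr0 addr0.
Qed.

Lemma inner_scale c (f g : fn) : L2 Omega f -> L2 Omega g ->
  inner Omega (scalefun c f) g = c * inner Omega f g.
Proof.
move=> f2 g2; rewrite -[RHS]addr0 -(inner_0l g2) -inner_lin //; last exact: L2_0.
by congr inner; apply/funext => x; rewrite /addfun addr0.
Qed.

Lemma inner_linr c (k f g : fn) : L2 Omega f -> L2 Omega g -> L2 Omega k ->
  inner Omega k (addfun (scalefun c f) g) =
  conjc c * inner Omega k f + inner Omega k g.
Proof.
move=> f2 g2 k2; rewrite (inner_conj (L2_lin mO c f2 g2) k2) inner_lin //.
by rewrite rmorphD rmorphM (inner_conj f2 k2) (inner_conj g2 k2).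
Qed.

(** A weak form of the Cauchy-Schwarz inequality, linear in the norm of g with
    a constant depending on f only, which is what continuity in g requires. *)
Lemma inner_bound (f g : fn) : L2 Omega f -> L2 Omega g ->
  Normc.normc (inner Omega f g) <= (L2norm Omega f ^+ 2 + 1) * (2 * L2norm Omega g).
Proof.
move=> f2 g2; have [g0|g0] := eqVneq (L2norm Omega g) 0.
  rewrite (inner_aeq f2 f2 g2 (L2_0 Omega) (aeq_refl _ _)); last first.
    exact: L2norm_eq0.
  by rewrite (inner_conj (L2_0 _) f2) inner_0l // conjc0 Normc.normc0 g0 !mulr0.
have gp : 0 < L2norm Omega g by rewrite lt_def g0 L2norm_ge0.
set t := L2norm Omega g in gp *.
(* |f g| <= t |f|^2 + |g|^2 / t; weighting by t = |g| makes the integral of the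
   right-hand side proportional to |g|. *)
have iZ (r : R) (h : _ -> R) : mu.-integrable Omega (EFin \o h) ->
    mu.-integrable Omega (EFin \o (fun x => r * h x)).
  exact: integrableZl.
have main (h : _ -> R) : mu.-integrable Omega (EFin \o h) ->
    (forall x, `|h x| <= t * nsq f x + t^-1 * nsq g x) ->
    `|\int[mu]_(x in Omega) h x| <= (L2norm Omega f ^+ 2 + 1) * t.
  move=> hi hle; apply: le_trans (le_normr_Rintegral mO hi) _.
  have -> : (L2norm Omega f ^+ 2 + 1) * t =
      \int[mu]_(x in Omega) (t * nsq f x + t^-1 * nsq g x).
    rewrite RintegralD //; try by apply: iZ; exact: L2_integrable.
    rewrite !RintegralZl -?L2norm_sqr ?L2_integrable//; try exact: L2_integrable.
    by rewrite -/t; field; exact: lt0r_neq0.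
  apply: le_Rintegral => //.
    exact: (integrable_abse hi).
  have iD (u w : _ -> R) : mu.-integrable Omega (EFin \o u) ->
      mu.-integrable Omega (EFin \o w) ->
      mu.-integrable Omega (EFin \o (fun x => u x + w x)).
    exact: integrableD.
  by apply: iD; apply: iZ; exact: L2_integrable.
have wt z w : Normc.normc z * Normc.normc w <=
    (t * Normc.normc z ^+ 2 + t^-1 * Normc.normc w ^+ 2) :> R.
  have := sqr_ge0 (t * Normc.normc z - Normc.normc w).
  move: (normc_ge0 z) (normc_ge0 w).
  move: (Normc.normc z) (Normc.normc w) => p q p0 q0 h.
  rewrite -(ler_pM2l gp) mulrDr [t * (t^-1 * _)]mulrA divff ?mul1r ?lt0r_neq0 //.
  have : 0 <= t * (p * q) by rewrite !mulr_ge0 // ltW.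
  nra.
have [fgr fgi] := L2_mul_cintegrable f2 (L2_conj mO g2).
rewrite (le_trans (normc_le_ReIm _)) // mulrCA mulr_natl mulr2n lerD //=.
  apply: main => // x; apply: le_trans (normr_Re_le _) _; rewrite Normc.normcM.
  by have := wt (f x) (g x); rewrite /conjfun; case: (g x) => a b /=; rewrite sqrrN.
apply: main => // x; apply: le_trans (normr_Im_le _) _; rewrite Normc.normcM.
by have := wt (f x) (g x); rewrite /conjfun; case: (g x) => a b /=; rewrite sqrrN.
Qed.

End inner_product.

(** * Smooth vectors of a linear graph *)

Section graphs.
Variables (R : realType) (n : nat) (Omega : set 'rV[R]_n).
Hypothesis mO : measurable Omega.
Local Notation fn := ('rV[R]_n -> R[i]).
Local Notation operator := (fn -> fn -> Prop).
Local Notation aeq := (aeq Omega).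
Local Notation L2 := (L2 Omega).

(** A linear operator on classes of functions modulo null sets: single valued
    and invariant up to almost everywhere equality, but not everywhere, which is
    why iterates can only be identified up to null sets below. *)
Definition linear_graph (T : operator) : Prop :=
  [/\ forall f g, T f g -> L2 f /\ L2 g,
      forall f g g', T f g -> T f g' -> aeq g g',
      forall f f' g, T f g -> aeq f f' -> L2 f' -> T f' g &
      forall c f f' g g', T f g -> T f' g' ->
        T (addfun (scalefun c f) f') (addfun (scalefun c g) g')].

Lemma HinfP (T : operator) f :
  Hinf Omega T f <-> L2 f /\ forall j, dom T (iter j (app T) f).
Proof.
split=> [h|[f2 h] k _]; last by split.
by split=> [|j]; [case: (h 1%N) | case: (h j.+1) => // _; apply].
Qed.

Lemma Hinf_L2 (T : operator) f : Hinf Omega T f -> L2 f.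
Proof. by case/HinfP. Qed.

Lemma appP (T : operator) f : dom T f -> T f (app T f).
Proof. by move=> [g fg]; apply: (@xgetPex _ (fun=> 0) [set g | T f g]); exists g. Qed.

Section graph.
Variable T : operator.
Hypothesis lT : linear_graph T.

(** The operation app picks an unspecified representative at every step. Any
    sequence of consecutive values computes its iterates all the same, since a
    change of representative can be undone by the invariance of the graph. *)
Lemma iter_app_chain (s : nat -> fn) f : (forall j, T (s j) (s j.+1)) ->
  L2 f -> aeq f (s 0%N) -> forall j,
  [/\ aeq (iter j (app T) f) (s j), L2 (iter j (app T) f) &
      dom T (iter j (app T) f)].
Proof.
have [tL2 tdet taeq _] := lT.
move=> Ts f2 fs; elim=> [|j [IHa IH2 IHd]]; [split => // | rewrite iterS].
  by exists (s 1%N); apply: taeq (Ts 0%N) (aeq_sym fs) f2.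
have Tj := taeq _ _ _ (Ts j) (aeq_sym IHa) IH2.
have Ta := appP IHd; have as' := tdet _ _ _ Ta Tj.
have [_ a2] := tL2 _ _ Ta.
by split => //; exists (s j.+2); apply: taeq (Ts j.+1) (aeq_sym as') a2.
Qed.

Lemma Hinf_chain (s : nat -> fn) f : (forall j, T (s j) (s j.+1)) ->
  L2 f -> aeq f (s 0%N) -> Hinf Omega T f.
Proof.
move=> Ts f2 fs; apply/HinfP; split => // j.
by have [] := iter_app_chain Ts f2 fs j.
Qed.

Lemma Hinf_lin c f g : Hinf Omega T f -> Hinf Omega T g ->
  Hinf Omega T (addfun (scalefun c f) g).
Proof.
move=> /HinfP[f2 df] /HinfP[g2 dg]; have [_ _ _ tlin] := lT.
pose s j := addfun (scalefun c (iter j (app T) f)) (iter j (app T) g).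
apply: (@Hinf_chain s); [|exact: L2_lin|exact: aeq_refl].
by move=> j; apply: tlin; rewrite iterS; apply: appP.
Qed.

Lemma eigenfunction_Hinf la f : T f (scalefun la f) -> Hinf Omega T f.
Proof.
move=> Tf; have [tL2 _ taeq tlin] := lT; have [f2 _] := tL2 _ _ Tf.
pose z : fn := scalefun 0 f.
have Tz : T z z.
  have := tlin (- 1) _ _ _ _ Tf Tf.
  have zE h : addfun (scalefun (-1) h) h = (fun=> 0) :> fn.
    by apply/funext => x; rewrite /addfun /scalefun mulN1r addNr.
  rewrite !zE; suff -> : z = (fun=> 0) by [].
  by apply/funext => x; rewrite /z /scalefun mul0r.
apply: (@Hinf_chain (fun j => scalefun (la ^+ j) f)) => //.
  move=> j; have := tlin (la ^+ j) _ _ _ _ Tf Tz.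
  have -> : addfun (scalefun (la ^+ j) f) z = scalefun (la ^+ j) f.
    by apply/funext => x; rewrite /addfun /scalefun /z /scalefun mul0r addr0.
  have -> // : addfun (scalefun (la ^+ j) (scalefun la f)) z = scalefun (la ^+ j.+1) f.
  by apply/funext => x; rewrite /addfun /scalefun /z /scalefun mul0r addr0 exprSr mulrA.
by apply: aeW => x Ox; rewrite /scalefun expr0 mul1r.
Qed.

Hypothesis T0 : T (fun=> 0) (fun=> 0).

Lemma aeq0_Hinf f : L2 f -> aeq f (fun=> 0) -> Hinf Omega T f.
Proof. by move=> f2 f0; apply: (@Hinf_chain (fun _ => fun=> 0)). Qed.

(** The seminorms see classes modulo null sets only; hence so does every
    continuous functional, see distribution_aeq. *)
Lemma aeq0_seminorm f k : L2 f -> aeq f (fun=> 0) -> seminorm Omega T k f = 0.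
Proof.
move=> f2 f0; rewrite /seminorm big1_idem //= ?maxxx // => j _.
have [a a2 _] := @iter_app_chain (fun _ => fun=> 0) f (fun=> T0) f2 f0 j.
exact: aeq0_L2norm.
Qed.

(** The seminorm of index 0 is the L2 norm, so boundedness in L2 is a
    sufficient condition for continuity. *)
Lemma bounded_distribution (w : fn -> R[i]) (B : R) :
  (forall c f g, Hinf Omega T f -> Hinf Omega T g ->
     w (addfun (scalefun c f) g) = c * w f + w g) ->
  (forall f, Hinf Omega T f -> Normc.normc (w f) <= B * L2norm Omega f) ->
  continuous_linear_form Omega T w.
Proof.
move=> wlin wB; split => // f hf e e0.
exists 0%N, (e / (`|B| + 1)); split=> [|g hg].
  by rewrite divr_gt0 // ltr_wpDl.
have -> : Defs.subfun g f = addfun (scalefun (-1) f) g.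
  by apply/funext => x; rewrite /Defs.subfun /addfun /scalefun mulN1r addrC.
rewrite ltr_pdivlMr ?ltr_wpDl // => h.
have -> : w g - w f = w (addfun (scalefun (-1) f) g) by rewrite wlin // mulN1r addrC.
apply: le_lt_trans (wB _ (Hinf_lin _ hf hg)) _; apply: le_lt_trans h.
rewrite /seminorm big_ord_recl big_ord0 /= mulrC.
have N0 := L2norm_ge0 Omega (addfun (scalefun (-1) f) g).
rewrite max_l //; apply: ler_wpM2l => //.
by apply: le_trans (ler_norm _) _; rewrite lerDl.
Qed.

(** All functions that vanish almost everywhere are at distance 0 from each
    other, so w takes a single value on them; linearity makes this value 0. The
    claim is this remark applied to f - c g. *)
Lemma distribution_aeq (w : fn -> R[i]) c f g : continuous_linear_form Omega T w ->
  Hinf Omega T f -> Hinf Omega T g -> aeq f (scalefun c g) -> w f = c * w g.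
Proof.
move=> [wlin wcont] hf hg fg.
have w0 z z' : L2 z -> L2 z' -> aeq z (fun=> 0) -> aeq z' (fun=> 0) -> w z = w z'.
  move=> z2 z2' z0 z0'; apply/eqP; rewrite -subr_eq0; apply/eqP.
  apply: Normc.eq0_normc; apply/eqP; rewrite eq_le normc_ge0 andbT.
  apply/ler_addgt0Pl => e e0; rewrite addr0.
  have [k [d [d0]]] := wcont _ (aeq0_Hinf z2' z0') e e0.
  move=> /(_ z (aeq0_Hinf z2 z0)) h; apply/ltW/h.
  have -> : Defs.subfun z z' = addfun (scalefun (-1) z') z.
    by apply/funext => x; rewrite /Defs.subfun /addfun /scalefun mulN1r addrC.
  rewrite aeq0_seminorm //; first exact: L2_lin.
  by have := aeq_comp2 (fun a b => -1 * a + b) z0' z0; rewrite mulr0 addr0.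
pose z := addfun (scalefun (- c) g) f.
have z2 : L2 z by apply: L2_lin => //; [exact: Hinf_L2 hg | exact: Hinf_L2 hf].
have z0 : aeq z (fun=> 0).
  by apply: filterS fg => x h /h; rewrite /z /addfun /scalefun => ->; rewrite mulNr addNr.
have wz : w z = 0.
  have /(w0 _ _ z2) h : L2 (addfun (scalefun 1 z) z) by exact: L2_lin.
  have := h z0; rewrite wlin; try exact: aeq0_Hinf.
  rewrite mul1r => {}h.
  have /h E : aeq (addfun (scalefun 1 z) z) (fun=> 0).
    by have := aeq_comp2 (fun a b => 1 * a + b) z0 z0; rewrite mulr0 addr0.
  by apply: (@addrI _ (w z)); rewrite -E addr0.
have := wlin (- c) _ _ hg hf; rewrite -/z wz mulNr => /esym/eqP.
by rewrite addrC subr_eq0 => /eqP.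
Qed.

End graph.

Section norm_equivalent.
Variables (I : choiceType) (u : I -> fn).
Hypothesis u2 : forall xi, L2 (u xi).
Hypothesis uN : norm_equivalent Omega u.

(** When f has a single nonzero coefficient the sum of squares reduces to one
    term. This bounds the elements dual to the family uniformly. *)
Lemma norm_equivalent_single : exists2 C : R, 0 < C &
  forall f a xi0, L2 f ->
    (forall xi, inner Omega f (u xi) = a * (xi0 == xi)%:R) ->
    L2norm Omega f ^+ 2 <= C * Normc.normc a ^+ 2.
Proof.
have [c [C [c0 C0 h]]] := uN; exists c^-1; first by rewrite invr_gt0.
move=> f a xi0 f2 fu; rewrite mulrC ler_pdivlMr // mulrC -lee_fin.
have /andP[hl _] := h f f2; apply: le_trans hl _.
rewrite (_ : \esum_(xi in _) _ = \esum_(xi in [set xi0]) (Normc.normc a ^+ 2)%:E)%E.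
  by rewrite esum_set1 // lee_fin sqr_ge0.
rewrite [RHS]esum_mkcond; apply: eq_esum => xi _; rewrite fu.
have [<-|ne] := eqVneq xi0 xi; first by rewrite mem_set // mulr1.
rewrite memNset ?mulr0 ?Normc.normc0 ?expr0n //= => xiE.
by rewrite xiE eqxx in ne.
Qed.

(** The lower frame bound makes the family total. *)
Lemma inner_eq0_aeq f : L2 f -> (forall xi, inner Omega f (u xi) = 0) ->
  aeq f (fun=> 0).
Proof.
move=> f2 f0; apply: L2norm_eq0 => //; apply/eqP; rewrite -sqrf_eq0 eq_le sqr_ge0 andbT.
have [c [C [c0 C0 /(_ f f2)/andP[h _]]]] := uN.
rewrite -(ler_pM2l c0) mulr0 -lee_fin; apply: le_trans h _.
by rewrite esum1 // => xi _; rewrite f0 Normc.normc0 expr0n.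
Qed.

Lemma inner_inj f g : L2 f -> L2 g ->
  (forall xi, inner Omega f (u xi) = inner Omega g (u xi)) -> aeq f g.
Proof.
move=> f2 g2 fg.
have : aeq (addfun (scalefun (-1) g) f) (fun=> 0).
  apply: inner_eq0_aeq => [|xi]; first exact: L2_lin.
  by rewrite inner_lin // fg mulN1r addNr.
apply: filterS => x h /h; rewrite /addfun /scalefun mulN1r addrC => /eqP.
by rewrite subr_eq0 => /eqP.
Qed.

(** An adjoint is single valued as soon as the domain of L contains a total
    family; eigenfunctions of L provide one. *)
Lemma linear_graph_adjoint (L : operator) (lam : I -> R[i]) :
  (forall h k, L h k -> L2 h /\ L2 k) ->
  (forall xi, L (u xi) (scalefun (lam xi) (u xi))) ->
  linear_graph (adjoint Omega L).
Proof.
move=> LL2 Lu; split.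
- by move=> f g [].
- move=> f g g' [f2 g2 fg] [_ g2' fg']; apply: inner_inj => // xi.
  rewrite (inner_conj mO (u2 xi) g2) (inner_conj mO (u2 xi) g2').
  by rewrite -(fg _ _ (Lu xi)) -(fg' _ _ (Lu xi)).
- move=> f f' g [f2 g2 fg] ff' f2'; split => // h k hk; have [h2 k2] := LL2 _ _ hk.
  rewrite -(fg _ _ hk); apply: inner_aeq => //; first exact: aeq_refl.
  exact: aeq_sym.
- move=> c f f' g g' [f2 g2 fg] [f2' g2' fg'].
  split; try exact: L2_lin.
  move=> h k hk; have [h2 k2] := LL2 _ _ hk.
  by rewrite !inner_linr // (fg _ _ hk) (fg' _ _ hk).
Qed.

Lemma adjoint0 (L : operator) : (forall h k, L h k -> L2 h /\ L2 k) ->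
  adjoint Omega L (fun=> 0) (fun=> 0).
Proof.
move=> LL2; split; try exact: L2_0.
move=> h k /LL2[h2 k2]; rewrite (inner_conj mO (L2_0 _) k2) inner_0l //.
by rewrite (inner_conj mO (L2_0 _) h2) inner_0l.
Qed.

End norm_equivalent.

End graphs.

(** * Geometrically dominated series *)

Section complex_series.
Variable R : realType.
Implicit Types z : nat -> R[i].

(** Sum of a complex series, computed on real and imaginary parts so that
    absolute convergence in the reals applies. *)
Definition csum z : R[i] :=
  Complex (limn (series (fun k => complex.Re (z k))))
          (limn (series (fun k => complex.Im (z k)))).

Definition geometrically_bounded (D : R) z :=
  forall k, Normc.normc (z k) <= D * 2^-1 ^+ k.

Lemma half_lt1 : `|2^-1 : R| < 1.
Proof. by rewrite ger0_norm ?invr_ge0 // invf_lt1 // ltr1n. Qed.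

Lemma geometric_dominated (D : R) (a : nat -> R) : (forall k, `|a k| <= D * 2^-1 ^+ k) ->
  cvgn (series a) /\ `|limn (series a)| <= D * 2.
Proof.
move=> aD.
have gc : cvgn (series (geometric D (2^-1 : R))) by exact: is_cvg_geometric_series half_lt1.
have nc : cvgn [normed series a].
  apply: series_le_cvg gc => k //=; exact: le_trans (aD k).
split; first exact: normed_cvg.
apply: le_trans (lim_series_norm nc) _.
apply: le_trans (lim_series_le nc gc aD) _.
rewrite (cvg_lim _ (cvg_geometric_series half_lt1)) //.
suff -> : (1 - 2^-1)^-1 = 2 :> R by [].
by field.
Qed.

Lemma csum_lin D E c z z' : geometrically_bounded D z -> geometrically_bounded E z' ->
  csum (fun k => c * z k + z' k) = c * csum z + csum z'.
Proof.
move=> zD zE; case: c => a b.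
have cr : cvgn (series (fun k => complex.Re (z k))).
  by have [] := @geometric_dominated D _ (fun k => le_trans (normr_Re_le (z k)) (zD k)).
have ci : cvgn (series (fun k => complex.Im (z k))).
  by have [] := @geometric_dominated D _ (fun k => le_trans (normr_Im_le (z k)) (zD k)).
have cr' : cvgn (series (fun k => complex.Re (z' k))).
  by have [] := @geometric_dominated E _ (fun k => le_trans (normr_Re_le (z' k)) (zE k)).
have ci' : cvgn (series (fun k => complex.Im (z' k))).
  by have [] := @geometric_dominated E _ (fun k => le_trans (normr_Im_le (z' k)) (zE k)).
have lim3 (r s : R) (x y t : nat -> R) : cvgn (series x) -> cvgn (series y) -> cvgn (series t) ->
    limn (series (r *: x + s *: y + t)) =
    r * limn (series x) + s * limn (series y) + limn (series t).
  move=> cx cy ct.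
  have cxy := is_cvg_seriesD (is_cvg_seriesZ (k := r) cx) (is_cvg_seriesZ (k := s) cy).
  rewrite (lim_seriesD cxy ct) (lim_seriesD (is_cvg_seriesZ cx) (is_cvg_seriesZ cy)).
  by rewrite !lim_seriesZ.
rewrite /csum.
rewrite (_ : (fun k => complex.Re (Complex a b * z k + z' k)) = a *: (fun k => complex.Re (z k)) +
   (- b) *: (fun k => complex.Im (z k)) + (fun k => complex.Re (z' k))); last first.
  by apply/funext => k; rewrite !fctE; case: (z k) (z' k) => [? ?] [? ?] /=; rewrite scaleNr.
rewrite (_ : (fun k => complex.Im (Complex a b * z k + z' k)) = a *: (fun k => complex.Im (z k)) +
   b *: (fun k => complex.Re (z k)) + (fun k => complex.Im (z' k))); last first.
  by apply/funext => k; rewrite !fctE; case: (z k) (z' k) => [? ?] [? ?] /=.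
by rewrite !lim3 //= mulNr.
Qed.

Lemma csum0 : csum (fun=> 0) = 0.
Proof.
have b0 : geometrically_bounded 0 (fun=> 0) by move=> k; rewrite Normc.normc0 mul0r.
suff E : csum (fun=> 0) = - 1 * csum (fun=> 0) + csum (fun=> 0).
  by rewrite E mulN1r addNr.
by rewrite -(csum_lin _ b0 b0); congr csum; apply/funext => k; rewrite mulr0 addr0.
Qed.

Lemma csumZ D c z : geometrically_bounded D z -> csum (fun k => c * z k) = c * csum z.
Proof.
move=> zD; rewrite -[RHS]addr0 -csum0 -(@csum_lin D 0) //.
  by congr csum; apply/funext => k; rewrite addr0.
by move=> k; rewrite Normc.normc0 mul0r.
Qed.

Lemma csum_bound D z : geometrically_bounded D z -> Normc.normc (csum z) <= D * 4.
Proof.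
move=> zD; apply: le_trans (normc_le_ReIm _) _ => /=.
have [_ hr] := @geometric_dominated D _ (fun k => le_trans (normr_Re_le (z k)) (zD k)).
have [_ hi] := @geometric_dominated D _ (fun k => le_trans (normr_Im_le (z k)) (zD k)).
by lra.
Qed.

(** This replaces the exact value of a sum of nonnegative terms where repetitions
    among the indices are not excluded. *)
Lemma csum_ge_term D z k : geometrically_bounded D z ->
  (forall j, 0 <= complex.Re (z j)) -> complex.Re (z k) <= Normc.normc (csum z).
Proof.
move=> zD z0; apply: le_trans (normr_Re_le _) => /=; apply: le_trans (ler_norm _).
have [cz _] := @geometric_dominated D _ (fun k => le_trans (normr_Re_le (z k)) (zD k)).
apply: (@le_trans _ _ (series (fun k => complex.Re (z k)) k.+1)).
  by rewrite /series /= big_nat_recr //= lerDr sumr_ge0.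
apply: nondecreasing_cvgn_le => //.
by apply: nondecreasing_series => j _ _.
Qed.

Definition half_pow (k : nat) : R[i] := Complex (2^-1 ^+ k) 0.

Lemma normc_half_pow k : Normc.normc (half_pow k) = 2^-1 ^+ k.
Proof. by rewrite /half_pow /= expr0n addr0 sqrtr_sqr ger0_norm ?exprn_ge0. Qed.

Lemma half_pow_bounded (D : R) (z : nat -> R[i]) : (forall k, Normc.normc (z k) <= D) ->
  geometrically_bounded D (fun k => half_pow k * z k).
Proof.
move=> zD k; rewrite Normc.normcM normc_half_pow mulrC.
by apply: ler_wpM2r => //; rewrite exprn_ge0 // invr_ge0.
Qed.

End complex_series.

(** * Functionals given by functions and by series of functions *)

Section pairings.
Variables (R : realType) (n : nat) (Omega : set 'rV[R]_n).
Hypothesis mO : measurable Omega.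
Local Notation fn := ('rV[R]_n -> R[i]).
Local Notation L2 := (L2 Omega).

Lemma embedE (f phi : fn) : embed Omega f phi = inner Omega f (conjfun phi).
Proof.
rewrite /embed /inner; congr cintegral; apply/funext => x.
by rewrite /conjfun conjcK.
Qed.

Lemma L2norm_conj (f : fn) : L2norm Omega (conjfun f) = L2norm Omega f.
Proof.
congr Num.sqrt; apply: eq_Rintegral => x _; rewrite !normc_sqr /conjfun.
by case: (f x) => a b /=; rewrite sqrrN.
Qed.

Lemma embed_lin (f phi psi : fn) c : L2 f -> L2 phi -> L2 psi ->
  embed Omega f (addfun (scalefun c phi) psi) =
  c * embed Omega f phi + embed Omega f psi.
Proof.
move=> f2 p2 q2; rewrite !embedE.
have -> : conjfun (addfun (scalefun c phi) psi) =
    addfun (scalefun (conjc c) (conjfun phi)) (conjfun psi).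
  by apply/funext => x; rewrite /conjfun /addfun /scalefun rmorphD rmorphM.
by rewrite inner_linr ?conjcK //; exact: L2_conj.
Qed.

Lemma embed_bound (f phi : fn) : L2 f -> L2 phi ->
  Normc.normc (embed Omega f phi) <= (L2norm Omega f ^+ 2 + 1) * (2 * L2norm Omega phi).
Proof.
move=> f2 p2; rewrite embedE -(L2norm_conj phi).
by apply: inner_bound => //; exact: L2_conj.
Qed.

Definition series_form (h : nat -> fn) (phi : fn) : R[i] :=
  csum (fun k => half_pow R k * embed Omega (h k) phi).

Variables (T : fn -> fn -> Prop).
Hypothesis lT : linear_graph Omega T.

Lemma embed_distribution f : L2 f -> continuous_linear_form Omega T (embed Omega f).
Proof.
move=> f2; apply: (bounded_distribution mO lT (B := (L2norm Omega f ^+ 2 + 1) * 2)).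
  by move=> c g h hg hh; apply: embed_lin => //; [exact: Hinf_L2 hg|exact: Hinf_L2 hh].
by move=> g hg; rewrite -mulrA; apply: embed_bound => //; exact: Hinf_L2 hg.
Qed.

(** The weights 2^-k are summable, so a family bounded in L2 yields a functional
    that is bounded in L2, hence a distribution. *)
Lemma series_form_distribution (h : nat -> fn) (B : R) :
  (forall k, L2 (h k)) -> (forall k, L2norm Omega (h k) ^+ 2 <= B) ->
  continuous_linear_form Omega T (series_form h).
Proof.
move=> h2 hB.
have bnd phi : L2 phi -> geometrically_bounded ((B + 1) * (2 * L2norm Omega phi))
    (fun k => half_pow R k * embed Omega (h k) phi).
  move=> p2; apply: half_pow_bounded => k; apply: le_trans (embed_bound (h2 k) p2) _.
  by rewrite ler_wpM2r ?mulr_ge0 ?L2norm_ge0 // lerD2r.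
apply: (bounded_distribution mO lT (B := (B + 1) * 2 * 4)).
  move=> c f g /Hinf_L2 f2 /Hinf_L2 g2.
  rewrite /series_form -(csum_lin c (bnd f f2) (bnd g g2)); congr csum.
  by apply/funext => k; rewrite embed_lin // mulrDr mulrCA.
move=> f /Hinf_L2 f2; apply: le_trans (csum_bound (bnd f f2)) _.
by rewrite le_eqVlt; apply/orP; left; apply/eqP; ring.
Qed.

End pairings.

(** * Multipliers and hypoellipticity *)

Section multiplier.
Variables (R : realType) (n m K : nat) (S : setting R n m K).
Local Notation fn := ('rV[R]_n -> R[i]).
Local Notation Omega := (Omega S).
Local Notation L := (L S).
Local Notation Ls := (adjoint Omega L).
Local Notation u := (u S).
Local Notation v := (v S).
Local Notation br := (bracket S).
Local Notation fourier := (fourier Omega v).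
Local Notation hat := (fourier_dist v).

Let mO : measurable Omega := open_measurable_rV (Omega_open (s := S)).

Let LL2 h k : L h k -> L2 Omega h /\ L2 Omega k.
Proof. by case. Qed.

Lemma u_L2 xi : L2 Omega (u xi). Proof. by have [] := u_eigen xi. Qed.
Lemma v_L2 xi : L2 Omega (v xi). Proof. by have [] := v_eigen xi. Qed.

Lemma adjoint_linear_graph : linear_graph Omega Ls.
Proof.
exact (linear_graph_adjoint mO u_L2 (u_norm_equivalent S) LL2 (@u_eigen _ _ _ _ S)).
Qed.

Lemma v_Hinf xi : Hinf Omega Ls (v xi).
Proof. exact (eigenfunction_Hinf adjoint_linear_graph (v_eigen xi)). Qed.

Lemma conj_v_Hinf xi : Hinf Omega Ls (conjfun (v xi)).
Proof. exact (@Lstar_conj_stable _ _ _ _ S _ (v_Hinf xi)). Qed.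

Lemma bracket_ge1 xi : 1 <= br xi.
Proof.
have h1 : 1 <= 1 + Normc.normc (lam S xi) ^+ 2 :> R by rewrite lerDl sqr_ge0.
rewrite /bracket -[leLHS](powRr0 (1 + Normc.normc (lam S xi) ^+ 2)).
by apply: ler_powR => //; rewrite invr_ge0 mulr_ge0.
Qed.

Lemma bracket_gt0 xi : 0 < br xi.
Proof. exact: lt_le_trans ltr01 (bracket_ge1 xi). Qed.

Lemma bracket_powRD xi r s : br xi `^ (r + s) = br xi `^ r * br xi `^ s.
Proof. by rewrite powRD // (gt_eqF (bracket_gt0 xi)) implybT. Qed.

Lemma in_Hinf_rapidly_decreasing w : in_Hinf Omega L w ->
  rapidly_decreasing br (hat w).
Proof.
move=> [f hf wf]; have [h _ _ _ _] := fourier_Hinf S.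
rewrite (_ : hat w = fourier f); first exact: h.
by apply/funext => xi; exact: wf (conj_v_Hinf xi).
Qed.

(** The sequence of coefficients is that of some test function f; the functional
    given by f is a distribution with the same coefficients as w, and these
    determine a distribution. *)
Lemma rapidly_decreasing_in_Hinf w : Defs.distribution Omega L w ->
  rapidly_decreasing br (hat w) -> in_Hinf Omega L w.
Proof.
move=> dw wrd; have [_ _ surj _ _] := fourier_Hinf S.
have [_ inj _] := fourier_distributions S.
have [f hf fw] := surj _ wrd; exists f => //; apply: inj => //.
exact: embed_distribution mO _ adjoint_linear_graph _ (Hinf_L2 hf).
Qed.

(** A smooth representative of the eigenfunction u xi, obtained from the
    surjectivity of the Fourier transform. *)
Lemma Hinf_delta xi : exists e, Hinf Omega L e /\
  fourier e = fun eta => (xi == eta)%:R.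
Proof.
have [_ _ surj _ _] := fourier_Hinf S.
have [|e he fe] := surj (fun eta => (xi == eta)%:R); last by exists e.
move=> M M0.
exists (br xi `^ M) => eta; rewrite normc_nat_bool.
have [<-|_] := eqVneq xi eta; last by rewrite mulr_ge0 ?powR_ge0.
by rewrite -bracket_powRD subrr powRr0.
Qed.

Variables (sigma : idx S -> R[i]) (P Pstar : fn -> fn).
Hypothesis hP : fourier_multiplier Omega L v P sigma.
Hypothesis hPstar : is_L2_adjoint Omega L P Pstar.

(** Tested against test functions f, the adjoint gives
    (f, P* v) = (P f, v) = sigma (f, v); the test functions that represent the
    u eta form a total family. *)
Lemma adjoint_eigenfunction xi :
  aeq Omega (Pstar (v xi)) (scalefun (conjc (sigma xi)) (v xi)).
Proof.
have [[PH _ _] Pmul] := hP; have [sH sadj] := hPstar.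
have s2 : L2 Omega (Pstar (v xi)) by exact: Hinf_L2 (sH _ (v_Hinf xi)).
have v2 := v_L2 xi.
have z2 : L2 Omega (scalefun (conjc (sigma xi)) (v xi)).
  rewrite (_ : scalefun _ _ = addfun (scalefun (conjc (sigma xi)) (v xi)) (fun=> 0)).
    by apply: L2_lin => //; exact: L2_0.
  by apply/funext => x; rewrite /addfun addr0.
apply: (inner_inj mO u_L2 (u_norm_equivalent S)) => // eta.
have [e [he fe]] := Hinf_delta eta; have e2 := Hinf_L2 he.
have ue : aeq Omega (u eta) e.
  apply: (inner_inj mO v_L2 (v_norm_equivalent S)) => // [|zeta]; first exact: u_L2.
  by rewrite biorthogonal -[RHS]/(fourier e zeta) fe.
rewrite (inner_conj mO (u_L2 eta) s2) (inner_conj mO (u_L2 eta) z2); congr conjc.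
have aux g : L2 Omega g -> inner Omega (u eta) g = inner Omega e g.
  by move=> g2; apply: inner_aeq => //; [exact: u_L2 | exact: aeq_refl].
rewrite !aux // -sadj //; last exact: v_Hinf.
rewrite -[LHS]/(fourier (P e) xi) Pmul // (inner_conj mO z2 e2) inner_scale //.
have conjM (a b : R[i]) : conjc (conjc a * b) = a * conjc b.
  by rewrite rmorphM /= conjcK.
by rewrite conjM -[fourier e xi]/(inner Omega e (v xi)) (inner_conj mO v2 e2).
Qed.

(** By adjoint_eigenfunction the extension evaluated at the conjugate of v xi
    is w evaluated at sigma times it, up to null sets, which w ignores. *)
Lemma fourier_extension w xi : Defs.distribution Omega L w ->
  hat (dist_extension Pstar w) xi = sigma xi * hat w xi.
Proof.
move=> dw; have [sH _] := hPstar; rewrite /fourier_dist /dist_extension conjfunK.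
apply: (distribution_aeq mO adjoint_linear_graph (adjoint0 mO LL2) dw).
- exact (@Lstar_conj_stable _ _ _ _ S _ (sH _ (v_Hinf xi))).
- exact: conj_v_Hinf.
- apply: filterS (adjoint_eigenfunction xi) => x h /h.
  by rewrite /conjfun /scalefun => ->; rewrite rmorphM /= conjcK.
Qed.

(** Where the bracket is at least M, dividing the coefficients of P w by the
    symbol costs a power of the bracket. On the remaining indices the bracket lies
    between 1 and M, so a growth bound for w is as good as a decay bound. *)
Lemma lower_bound_hypoelliptic (M : R) : 0 < M ->
  (forall xi, M <= br xi -> br xi `^ (- M) < Normc.normc (sigma xi)) ->
  globally_hypoelliptic Omega L (dist_extension Pstar).
Proof.
move=> M0 hM w dw /in_Hinf_rapidly_decreasing Pw.
apply: rapidly_decreasing_in_Hinf => // M' M'0.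
have [slow _ _] := fourier_distributions S.
have [C0 [N [C00 N0 hw]]] := slow w dw.
have [C1 hC1] := Pw _ (addr_gt0 M0 M'0).
(* C1 serves the indices with M <= br xi; on the others
   br^N = br^(N + M') br^-M' <= M^(N + M') br^-M'. *)
exists (`|C1| + C0 * M `^ (N + M')) => xi.
have bp s : 0 < br xi `^ s by rewrite powR_gt0 // bracket_gt0.
have [Mx|xM] := leP M (br xi).
  have := hC1 xi; rewrite fourier_extension // Normc.normcM opprD bracket_powRD => h.
  apply: (@le_trans _ _ (`|C1| * br xi `^ (- M'))); last first.
    by rewrite ler_wpM2r ?powR_ge0 // lerDl mulr_ge0 ?powR_ge0 // ltW.
  rewrite -(ler_pM2l (bp (- M))).
  apply: (@le_trans _ _ (Normc.normc (sigma xi) * Normc.normc (hat w xi))).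
    by rewrite ler_wpM2r ?normc_ge0 // ltW // hM.
  apply: le_trans h _; rewrite [leRHS]mulrCA; apply: ler_wpM2r; last exact: ler_norm.
  by rewrite mulr_ge0 // ltW.
apply: le_trans (hw xi) _.
apply: (@le_trans _ _ (C0 * M `^ (N + M') * br xi `^ (- M'))); last first.
  by rewrite ler_wpM2r ?powR_ge0 // lerDr.
rewrite -mulrA; apply: ler_wpM2l; first exact: ltW.
rewrite -[X in br xi `^ X <= _](addrK M') bracket_powRD ler_wpM2r ?powR_ge0 //.
apply: ge0_ler_powR; rewrite ?nnegrE; try exact: ltW.
- by rewrite addr_ge0 // ltW.
- exact/ltW/bracket_gt0.
Qed.

Lemma multiplier_delta_norm : exists2 C : R, 0 < C & forall xi e, Hinf Omega L e ->
  fourier e = (fun eta => (xi == eta)%:R) ->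
  L2norm Omega e ^+ 2 <= C /\
  L2norm Omega (P e) ^+ 2 <= C * Normc.normc (sigma xi) ^+ 2.
Proof.
have [[PH _ _] Pmul] := hP.
have [C C0 hC] := norm_equivalent_single (v_norm_equivalent S).
exists C => // xi e he fe; split.
  have := hC e 1 xi (Hinf_L2 he); rewrite Normc.normc1 expr1n mulr1; apply => eta.
  by rewrite mul1r -[LHS]/(fourier e eta) fe.
apply: (hC _ _ xi (Hinf_L2 (PH _ he))) => eta.
rewrite -[LHS]/(fourier (P e) eta) Pmul // fe.
by have [->|] := eqVneq xi eta; rewrite ?mulr0.
Qed.

(** Moving the adjoint to the left of each pairing turns the extension applied to
    a series of functions into the series of their images under P. It
    takes the place of a continuity argument for P*. *)
Lemma extension_series_form (e : nat -> fn) phi : (forall k, Hinf Omega L (e k)) ->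
  Hinf Omega Ls phi ->
  dist_extension Pstar (series_form Omega e) phi =
  series_form Omega (fun k => P (e k)) phi.
Proof.
move=> he hphi; congr csum; apply/funext => k; congr (_ * _).
have [_ sadj] := hPstar; rewrite !embedE conjfunK -sadj //.
exact (@Lstar_conj_stable _ _ _ _ S _ hphi).
Qed.

(** If the lower bound fails for M = 4^k, it fails at some x k with bracket at
    least 4^k. The coefficients of w = sum 2^-k e_k, with e_k the test function of
    coefficients delta at x k, do not decay like 1 / bracket along x k, whereas
    multiplied by sigma they decay faster than any power. *)
Lemma hypoelliptic_lower_bound :
  globally_hypoelliptic Omega L (dist_extension Pstar) ->
  exists M : R, 0 < M /\ forall xi,
    M <= br xi -> br xi `^ (- M) < Normc.normc (sigma xi).
Proof.
move=> hypo; apply: contrapT => noM.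
have two_k k : (k%:R : R) <= 2 ^+ k by rewrite -natrX ler_nat ltnW // ltn_expl.
have four_k k : (k%:R : R) <= 4 ^+ k by rewrite -natrX ler_nat ltnW // ltn_expl.
have bad k : exists xi, 4 ^+ k <= br xi /\
    Normc.normc (sigma xi) <= br xi `^ (- 4 ^+ k).
  apply: contrapT => nobad; apply: noM; exists (4 ^+ k); split=> [|xi xik].
    by rewrite exprn_gt0.
  by rewrite ltNge; apply/negP => small; apply: nobad; exists xi.
have [x xP] := choice bad.
have [e eP] := choice (fun k => Hinf_delta (x k)).
have he k : Hinf Omega L (e k) by have [] := eP k.
have fe k : fourier (e k) = (fun eta => (x k == eta)%:R) by have [] := eP k.
have [[PH _ _] Pmul] := hP.
have [C C0 hC] := multiplier_delta_norm.
have sigma_le1 k : Normc.normc (sigma (x k)) <= 1.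
  apply: le_trans (xP k).2 _; rewrite powRN invf_le1; last exact/powR_gt0/bracket_gt0.
  rewrite -[leLHS](powRr0 (br (x k))); apply: ler_powR; first exact: bracket_ge1.
  by rewrite exprn_ge0.
pose w := series_form Omega e.
pose w' := series_form Omega (fun k => P (e k)).
have dw : Defs.distribution Omega L w.
  apply: (series_form_distribution mO adjoint_linear_graph (B := C)) => k.
    exact: Hinf_L2 (he k).
  by have [] := hC _ _ (he k) (fe k).
have dw' : Defs.distribution Omega L w'.
  apply: (series_form_distribution mO adjoint_linear_graph (B := C)) => k.
    exact: Hinf_L2 (PH _ (he k)).
  have [_ /le_trans] := hC _ _ (he k) (fe k); apply.
  by rewrite -[leRHS]mulr1 ler_wpM2l ?exprn_ile1 ?normc_ge0 // ltW.
pose d xi := csum (fun k => half_pow R k * (x k == xi)%:R).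
have dbound xi : geometrically_bounded 1 (fun k => half_pow R k * (x k == xi)%:R).
  by apply: half_pow_bounded => k; rewrite normc_nat_bool; case: (_ == _).
have hatw xi : hat w xi = d xi.
  congr csum; apply/funext => k; congr (_ * _).
  by rewrite -[LHS]/(fourier (e k) xi) fe.
have hatw' xi : hat w' xi = sigma xi * d xi.
  rewrite -(csumZ _ (dbound xi)); congr csum; apply/funext => k.
  by rewrite mulrCA; congr (_ * _); rewrite -[LHS]/(fourier (P (e k)) xi) Pmul // fe.
have d4 xi : Normc.normc (d xi) <= 4 by have := csum_bound (dbound xi); rewrite mul1r.
have w'rd : rapidly_decreasing br (hat w').
  move=> M M0; pose N := Num.Def.archi_bound M.
  pose term k := 4 * (Normc.normc (sigma (x k)) * br (x k) `^ M).
  have term0 k : 0 <= term k by rewrite !mulr_ge0 ?normc_ge0 ?powR_ge0.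
  (* For k >= N one has 4^k >= k >= M; the finitely many other indices enter the
     constant through term. *)
  exists (4 + \sum_(k < N) term k) => xi; rewrite hatw' Normc.normcM.
  have sum0 : 0 <= \sum_(k < N) term k by apply: sumr_ge0 => k _.
  have [[k xk]|nox] := pselect (exists k, x k = xi); last first.
    rewrite (_ : d xi = 0) ?Normc.normc0 ?mulr0 ?mulr_ge0 ?powR_ge0 ?addr_ge0 //.
    rewrite -(csum0 R); congr csum; apply/funext => k.
    by case: eqP => [xk|_]; [case: nox; exists k | rewrite mulr0].
  apply: (@le_trans _ _ (4 * Normc.normc (sigma xi))).
    by rewrite mulrC ler_wpM2r ?normc_ge0.
  have [kN|Nk] := ltnP k N.
    apply: (@le_trans _ _ (term k * br xi `^ (- M))).
      rewrite /term xk -!mulrA -bracket_powRD subrr powRr0 mulr1 //.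
    rewrite ler_wpM2r ?powR_ge0 // (bigD1 (Ordinal kN)) //= addrCA lerDl.
    by rewrite addr_ge0 // sumr_ge0.
  apply: (@le_trans _ _ (4 * br xi `^ (- M))); last first.
    by rewrite ler_wpM2r ?powR_ge0 // lerDl.
  rewrite ler_wpM2l //; have [_] := xP k; rewrite xk => /le_trans; apply.
  apply: ler_powR; first exact: bracket_ge1.
  rewrite lerN2; apply: le_trans (four_k k).
  by apply: le_trans (ltW (archi_boundP (ltW M0))) _; rewrite ler_nat.
have [f hf wf] := rapidly_decreasing_in_Hinf dw' w'rd.
have wrd : rapidly_decreasing br (hat w).
  apply/in_Hinf_rapidly_decreasing/hypo => //; exists f => // phi hphi.
  by rewrite extension_series_form //; exact: wf.
have [D hD] := wrd 1 ltr01.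
(* At x k the coefficient is at least 2^-k, and decay like 1 / bracket would make
   it at most D 4^-k. *)
have D2 k : 2 ^+ k <= `|D|.
  have dk : 2^-1 ^+ k <= Normc.normc (d (x k)).
    apply: le_trans (csum_ge_term k (dbound (x k)) _) => [|j].
      by rewrite eqxx mulr1.
    by case: (_ == _); rewrite ?mulr1 ?mulr0 //= exprn_ge0 // invr_ge0.
  have h : 2^-1 ^+ k <= `|D| * (4 ^+ k)^-1.
    apply: le_trans dk _; rewrite -hatw; apply: le_trans (hD _) _.
    apply: (@le_trans _ _ (`|D| * br (x k) `^ (- 1))).
      by rewrite ler_wpM2r ?powR_ge0 // ler_norm.
    rewrite ler_wpM2l // powRN powRr1 ?(ltW (bracket_gt0 _)) //.
    by rewrite lef_pV2 ?posrE ?bracket_gt0 ?exprn_gt0 //; have [] := xP k.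
  move: h; rewrite ler_pdivlMr ?exprn_gt0 // -exprMn.
  by rewrite (_ : 2^-1 * 4 = 2) //; field.
have := le_lt_trans (le_trans (two_k (Num.Def.archi_bound `|D|)) (D2 _))
  (archi_boundP (normr_ge0 D)).
by rewrite ltxx.
Qed.

End multiplier.

Theorem theorem3p2 (R : realType) (n m K : nat) (S : setting R n m K)
  (sigma : idx S -> R[i]) (P Pstar : ('rV[R]_n -> R[i]) -> ('rV[R]_n -> R[i]))
  (hP : fourier_multiplier (Omega S) (L S) (v S) P sigma)
  (hPstar : is_L2_adjoint (Omega S) (L S) P Pstar) :
  globally_hypoelliptic (Omega S) (L S) (dist_extension Pstar) <->
  exists M : R, 0 < M /\ forall xi : idx S,
    M <= bracket S xi -> bracket S xi `^ (- M) < Normc.normc (sigma xi).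
Proof.
split=> [|[M [M0 hM]]]; first exact: hypoelliptic_lower_bound hP hPstar.
exact (lower_bound_hypoelliptic hP hPstar M0 hM).
Qed.
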